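(* Let $P$ be a diced polytope in $\mathbb{R}^n_{\ge 0}$, and let $X$ be any polytopal subdivision of $P$ all of whose cells are totally sharp polytopes. Then $X$ together with the labeling $\ell$ is a cellular resolution of the ideal $I_P$.
   Context: $\mathbb{K}$ is a field and all monomials are monic monomials in $\mathbb{K}[x_1,\ldots,x_n]$. Cells are closed, and $V(\cdot)$ denotes the set of vertices (zero-dimensional cells) of a polytope, cell or cell complex. Cellular resolutions. A labeled cell complex is a (CW) cell complex $X$ with a map $\ell$ from its cells to monomials such that $\ell(\sigma)=\mathrm{lcm}\{\ell(v)\mid v\in V(\sigma)\}$ for every cell $\sigma$. A labeled cell complex $X$ is a cellular resolution of the ideal $I=\langle \ell(v)\mid v\in V(X)\rangle$ if for every monomial $m$ the subcomplex $\{\sigma\in X\mid \ell(\sigma)\text{ divides } m\}$ is either empty or acyclic over $\mathbb{K}$. Polytopes. A polytope in $\mathbb{R}^n$ is a lattice polytope if all its vertices lie in $\mathbb{Z}^n$. For a lattice polytope $P\subset\mathbb{R}^n_{\ge0}$, let $I_P=\langle x_1^{e_1}\cdots x_n^{e_n}\mid (e_1,\ldots,e_n)\in P\cap\mathbb{Z}^n\rangle$. For $i\in\{1,\ldots,n\}$ and $j\in\mathbb{Z}$ let $H_{i,j}=\{(e_1,\ldots,e_n)\in\mathbb{R}^n\mid e_i=j\}$. $X_P$ is the subdivision of $P$ (as a polytopal complex) obtained by cutting $P$ with all hyperplanes $H_{i,j}$. The lattice polytope $P$ is diced if $P\cap\mathbb{Z}^n=V(X_P)$. For a diced polytope $P$,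 $\ell(P)=\mathrm{lcm}\{x_1^{e_1}\cdots x_n^{e_n}\mid (e_1,\ldots,e_n)\in P\cap\mathbb{Z}^n\}$. A lattice point $v=(e_1,\ldots,e_n)$ has label $\ell(v)=x_1^{e_1}\cdots x_n^{e_n}$, and a cell of a complex whose vertices are lattice points is labeled by the lcm of the labels of its vertices. A diced polytope $P$ is sharp if there is a cell $\sigma_P\in X_P$ with $\dim\sigma_P=\dim P$ and $\ell(\sigma_P)=\ell(P)$. A diced polytope is totally sharp if all of its faces (including itself) are sharp (in particular diced). *)

(* Defs.v *)
From HB Require Import structures.
From mathcomp Require Import all_boot all_order all_algebra.
From mathcomp.multinomials Require Import freeg mpoly.
From mathcomp Require Import boolp classical_sets functions cardinality.
From mathcomp Require Import reals topology normedtype.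

Set Implicit Arguments.
Unset Strict Implicit.
Unset Printing Implicit Defensive.

Import Order.TTheory GRing.Theory Num.Theory.
Import numFieldNormedType.Exports.

Local Open Scope classical_set_scope.
Local Open Scope ring_scope.

Section Polytopes.
Variables (R : realType) (n : nat).
Local Notation Rn := 'rV[R]_n.

Definition dot (c x : Rn) : R := \sum_i c 0 i * x 0 i.

Definition conv_hull (k : nat) (p : 'I_k -> Rn) : set Rn :=
  [set x | exists w : 'I_k -> R,
    [/\ forall i, 0 <= w i, \sum_i w i = 1 & x = \sum_i w i *: p i]].

Definition polytope (P : set Rn) : Prop :=
  exists k (p : 'I_k -> Rn), P = conv_hull p.

(* The nonempty faces of [P]; [P] itself is obtained with [c = 0], [b = 0].   *)
(* The empty face is left out, so that the faces of [P] are the cells of the  *)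
(* face complex of [P].                                                       *)
Definition faces (P : set Rn) : set (set Rn) :=
  [set F | F !=set0 /\ exists (c : Rn) (b : R),
    (forall x, P x -> dot c x <= b) /\ F = P `&` [set x | dot c x = b]].

Definition verts (X : set (set Rn)) : set Rn := [set v | X [set v]].

Definition polytopal_complex (X : set (set Rn)) : Prop :=
  [/\ finite_set X,
      forall s, X s -> polytope s /\ s !=set0,
      forall s F, X s -> faces s F -> X F
    & forall s t, X s -> X t -> s `&` t !=set0 ->
        faces s (s `&` t) /\ faces t (s `&` t)].

Definition polytopal_subdivision (P : set Rn) (X : set (set Rn)) : Prop :=
  polytopal_complex X /\ \bigcup_(s in X) s = P.

(* Dimension of the affine hull: the largest [k] such that [A] contains       *)
(* [k + 1] affinely independent points (and 0 for the empty set).             *)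
Definition affdim (A : set Rn) : nat :=
  \max_(k < n.+1 | `[< exists (x : Rn) (M : 'M[R]_(k, n)),
    [/\ A x, forall i, A (x + row i M) & row_free M] >]) k.

Definition lattice_point (x : Rn) : Prop := forall i, x 0 i \is a Num.int.

Definition lattice_polytope (P : set Rn) : Prop :=
  polytope P /\ verts (faces P) `<=` lattice_point.

(* Position of [x] relative to the hyperplane [x_i = j]: [Lt] and [Gt] are    *)
(* the two closed half-spaces, [Eq] the hyperplane itself.                    *)
Definition on_side (i : 'I_n) (j : int) (c : comparison) : set Rn :=
  [set x | match c with
           | Lt => x 0 i <= j%:~R
           | Eq => x 0 i = j%:~R
           | Gt => j%:~R <= x 0 i
           end].

(* The subdivision of [P] cut out by all hyperplanes [x_i = j], [j : int].    *)
Definition cut_complex (P : set Rn) : set (set Rn) :=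
  [set s | s !=set0 /\ exists F (e : 'I_n -> int -> comparison),
    faces P F /\ s = F `&` [set x | forall i j, on_side i j (e i j) x]].

Definition diced (P : set Rn) : Prop :=
  lattice_polytope P /\ P `&` lattice_point = verts (cut_complex P).

(* The monomial with exponent vector [m], as a point of R^n. *)
Definition vec (m : 'X_{1..n}) : Rn := \row_i (m i)%:R.

(* Monomials are compared by divisibility, which is [lem], i.e. [<=%MM]. *)
Definition is_lcm (S : set 'X_{1..n}) (m : 'X_{1..n}) : Prop :=
  (forall s, S s -> (s <= m)%MM) /\
  (forall m', (forall s, S s -> (s <= m')%MM) -> (m <= m')%MM).

(* A least common multiple exists exactly when [S] is bounded; the value is   *)
(* the monomial 1 otherwise.                                                  *)
Definition lcm_of (S : set 'X_{1..n}) : 'X_{1..n} := xget 0%MM (is_lcm S).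

Definition cell_label (s : set Rn) : 'X_{1..n} :=
  lcm_of [set m | verts (faces s) (vec m)].

Definition polytope_label (P : set Rn) : 'X_{1..n} :=
  lcm_of [set m | P (vec m)].

Definition sharp (P : set Rn) : Prop :=
  diced P /\ exists s, [/\ cut_complex P s, affdim s = affdim P
                         & cell_label s = polytope_label P].

Definition totally_sharp (P : set Rn) : Prop :=
  forall F, faces P F -> sharp F.

End Polytopes.

Section SingularHomology.
Variables (R : realType) (K : fieldType) (n : nat).

Definition std_simplex (k : nat) : set 'rV[R]_k.+1 :=
  [set t | (forall i, 0 <= t 0 i) /\ \sum_i t 0 i = 1].
Arguments std_simplex k : clear implicits.

(* A singular simplex is a function on the whole coordinate space that is     *)
(* zero outside the standard simplex, so that equality of simplices is        *)
(* equality of functions.                                                     *)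
Definition singular_simplex (U : set 'rV[R]_n) (k : nat)
    (s : 'rV[R]_k.+1 -> 'rV[R]_n) : Prop :=
  [/\ {within std_simplex k, continuous s},
      forall t, std_simplex k t -> U (s t)
    & forall t, ~ std_simplex k t -> s t = 0].

Definition coface (k : nat) (i : 'I_k.+2) (t : 'rV[R]_k.+1) : 'rV[R]_k.+2 :=
  \row_j (if unlift i j is Some j' then t 0 j' else 0).

Definition simplex_face (k : nat) (i : 'I_k.+2)
    (s : 'rV[R]_k.+2 -> 'rV[R]_n) : 'rV[R]_k.+1 -> 'rV[R]_n :=
  patch (fun=> 0) (std_simplex k) (s \o coface i).

Definition chain (k : nat) := {freeg ('rV[R]_k.+1 -> 'rV[R]_n) / K}.

Definition singular_chain (U : set 'rV[R]_n) (k : nat) (c : chain k) : Prop :=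
  forall s, s \in dom c -> singular_simplex U s.

Definition boundary (k : nat) (c : chain k.+1) : chain k :=
  fglift (fun s => \sum_(i < k.+2) (-1) ^+ i *: << simplex_face i s >>) c.

Definition augmentation (c : chain 0) : K := fglift (fun=> 1 : K^o) c.

(* All reduced singular homology groups of [U] over [K] vanish; in degree -1  *)
(* this says that [U] is nonempty.                                            *)
Definition acyclic (U : set 'rV[R]_n) : Prop :=
  [/\ U !=set0,
      forall c : chain 0, singular_chain U c -> augmentation c = 0 ->
        exists b : chain 1, singular_chain U b /\ boundary b = c
    & forall k (c : chain k.+1), singular_chain U c -> boundary c = 0 ->
        exists b : chain k.+2, singular_chain U b /\ boundary b = c].

End SingularHomology.

Section CellularResolutions.
Variables (R : realType) (K : fieldType) (n : nat).
Local Notation Rn := 'rV[R]_n.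

Definition ideal_gen (S : set {mpoly K[n]}) : set {mpoly K[n]} :=
  [set p | exists k (a g : 'I_k -> {mpoly K[n]}),
    (forall i, S (g i)) /\ p = \sum_i a i * g i].

Definition lattice_ideal (P : set Rn) : set {mpoly K[n]} :=
  ideal_gen [set 'X_[m] | m in [set m | P (vec R m)]].

Definition labeled_complex (X : set (set Rn)) (l : set Rn -> 'X_{1..n}) :=
  polytopal_complex X /\
  forall s, X s -> is_lcm [set l [set v] | v in verts (faces s)] (l s).

Definition subcomplex_le (X : set (set Rn)) (l : set Rn -> 'X_{1..n})
    (m : 'X_{1..n}) : set (set Rn) :=
  [set s | X s /\ (l s <= m)%MM].

Definition cellular_resolution (X : set (set Rn)) (l : set Rn -> 'X_{1..n})
    (I : set {mpoly K[n]}) : Prop :=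
  [/\ labeled_complex X l,
      I = ideal_gen [set 'X_[l [set v]] | v in verts X]
    & forall m, subcomplex_le X l m = set0 \/
                acyclic K (\bigcup_(s in subcomplex_le X l m) s)].

End CellularResolutions.
Arguments lattice_ideal {R} K {n} P _.

(* Main.v *)
Require Import Defs.
From HB Require Import structures.
From mathcomp Require Import all_boot all_order all_algebra.
From mathcomp.multinomials Require Import freeg mpoly.
From mathcomp Require Import boolp classical_sets functions cardinality.
From mathcomp Require Import reals topology normedtype.
From mathcomp Require Import ring lra.

Set Implicit Arguments.
Unset Strict Implicit.
Unset Printing Implicit Defensive.

Import Order.TTheory GRing.Theory Num.Theory.
Import numFieldNormedType.Exports.

Local Open Scope classical_set_scope.
Local Open Scope ring_scope.

(** Fix a monomial m and let B be the set of points whose exponents are at most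
those of m. The part of the convex set P inside B is convex, hence acyclic by
the cone construction on singular chains ([acyclic_convex]). It is cut by the
cells of X, and the claim follows once it is shown that it retracts onto the
union of the good cells, those whose label divides m: a retract of an acyclic
set is acyclic, since a cycle of the retract bounds in the larger set and the
retraction pushes the bounding chain back ([acyclic_retract]).

The bad cells are removed one at a time, a bad cell s of maximal dimension
first ([remove_cell]). Sharpness gives a cell t of the cut complex of s, of full
dimension and with the label of s. In a coordinate i where the label of s
exceeds m, t reaches the maximum M of the coordinate on s, and t lies between two
consecutive hyperplanes, so all of t lies in x_i >= M - 1 >= m_i. The average p
of enough points of t therefore is a relative interior point of s with
p_i > m_i in every such coordinate ([sharp_point]). Pushing the points of s
away from p onto the boundary of s does not increase these coordinates beyond
m_i, and the other coordinates are at most m_i on all of s. So the radial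
projection from p retracts the part of s in B to the boundary of s in B, and
glued with the identity it removes s. The remaining cells still form a complex,
because s lies in no other remaining cell.

The polytope theory behind this comes from the Farkas lemma ([farkas]): a convex
hull is the set of points that satisfy all inequalities valid on the
generators ([conv_hullP]), a polytope is the hull of its vertices
([polytope_verts]), and a point that cannot be moved further away from p lies on
a proper face ([boundary_point]). The last fact identifies the radial projection
with an explicit formula in the maximum of finitely many affine functions, one
for each proper face, which is why it is continuous ([radial_retraction]).

The same retractions show that a lattice point m of P dominates a vertex of X:
the set of good cells cannot be empty when P meets B. This yields the equality
of ideals. *)

(** * The Farkas lemma and convex hulls *)

Section Dot.
Variables (R : realType) (n : nat).
Implicit Types (c d x y : 'rV[R]_n) (a b : R).

Lemma dotDr c x y : dot c (x + y) = dot c x + dot c y.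
Proof. by rewrite /dot -big_split /=; apply: eq_bigr => i _; rewrite mxE mulrDr. Qed.

Lemma dotZr c a x : dot c (a *: x) = a * dot c x.
Proof. by rewrite /dot mulr_sumr; apply: eq_bigr => i _; rewrite mxE mulrCA. Qed.

Lemma dotBr c x y : dot c (x - y) = dot c x - dot c y.
Proof. by rewrite -scaleN1r dotDr dotZr mulN1r. Qed.

Lemma dot0r c : dot c 0 = 0.
Proof. by rewrite -(scale0r (0 : 'rV_n)) dotZr mul0r. Qed.

Lemma dotC c x : dot c x = dot x c.
Proof. by apply: eq_bigr => i _; rewrite mulrC. Qed.

Lemma dot0l x : dot 0 x = 0.
Proof. by rewrite dotC dot0r. Qed.

Lemma dotZl a c x : dot (a *: c) x = a * dot c x.
Proof. by rewrite dotC dotZr dotC. Qed.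

Lemma dotBl c d x : dot (c - d) x = dot c x - dot d x.
Proof. by rewrite dotC dotBr !(dotC x). Qed.

Lemma dot_sumr c (I : finType) (p : I -> 'rV[R]_n) :
  dot c (\sum_i p i) = \sum_i dot c (p i).
Proof.
elim/big_ind2: _ => [|x a y b <- <-|//]; [exact: dot0r | exact: dotDr].
Qed.

Lemma dot_delta i x : dot (delta_mx 0 i) x = x 0 i.
Proof.
rewrite /dot (bigD1 i) //= big1 => [|j /negPf ji].
  by rewrite mxE !eqxx mul1r addr0.
by rewrite mxE ji andbF mul0r.
Qed.

Lemma dot_self_gt0 x : x != 0 -> 0 < dot x x.
Proof.
have sq_ge0 i : true -> 0 <= x 0 i * x 0 i by rewrite -expr2 sqr_ge0.
move=> x0; rewrite lt_neqAle sumr_ge0 // andbT eq_sym psumr_eq0 //.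
apply: contra x0 => /allP xx; apply/eqP/rowP => i; apply/eqP; rewrite mxE.
by move: (xx i); rewrite mem_index_enum mulf_eq0 orbb; apply.
Qed.

End Dot.

(** Appending a constant entry turns an affine function into a linear one, so that
statements on cones apply to convex hulls. *)
Lemma dot_row_mx (R : realType) n (c x : 'rV[R]_n) (a b : R) :
  dot (row_mx c a%:M) (row_mx x b%:M : 'rV_(n + 1)) = dot c x + a * b.
Proof.
rewrite /dot big_split_ord /= big_ord1 !row_mxEr !mxE !mulr1n; congr (_ + _).
by apply: eq_bigr => i _; rewrite !row_mxEl.
Qed.

(** Induction on the number of generators. If dropping the first generator a breaks
the hypothesis, some c0 is nonpositive on the others and positive on d, hence on
a. Projecting all vectors along a to the kernel of c0 preserves the hypothesis,
and lifting the representation of the projection of d back gives a the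
coefficient below, which is nonnegative by the signs of c0. *)
Lemma farkas (R : realType) n k (u : 'I_k -> 'rV[R]_n) (d : 'rV[R]_n) :
  (forall c, (forall i, dot c (u i) <= 0) -> dot c d <= 0) ->
  exists w : 'I_k -> R, (forall i, 0 <= w i) /\ d = \sum_i w i *: u i.
Proof.
elim: k u d => [|k IHk] u d dual.
  exists (fun=> 0); split=> //; rewrite big_ord0.
  apply: contrapT => /eqP /dot_self_gt0; rewrite ltNge => /negP; apply.
  by apply: dual; case.
have [noc|/existsNP[c0 /not_implyP[c0u /negP]]] :=
    pselect (forall c, (forall i, dot c (u (fintype.lift ord0 i)) <= 0) -> dot c d <= 0).
  have [w [w0 ->]] := IHk (fun i => u (fintype.lift ord0 i)) d noc.
  exists (fun i => if unlift ord0 i is Some j then w j else 0); split.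
    by move=> i; case: unliftP.
  rewrite big_ord_recl unlift_none scale0r add0r.
  by apply: eq_bigr => i _; rewrite liftK.
rewrite -ltNge => c0d; set a := u ord0; set s := dot c0 a.
have s_gt0 : 0 < s.
  rewrite ltNge; apply/negP => s_le0; move: c0d; rewrite ltNge => /negP; apply.
  by apply: dual => i; case: (unliftP ord0 i) => [j|] ->.
have sN0 : s != 0 by rewrite gt_eqF.
pose t x := dot c0 x / s.
have [|w [w0 dE]] := IHk
  (fun i => u (fintype.lift ord0 i) - t (u (fintype.lift ord0 i)) *: a) (d - t d *: a).
  (* Moving c along c0 until it vanishes on a does not change its values on
     the projected vectors. *)
  move=> c cu; pose c' := c - (dot c a / s) *: c0.
  have c'E x : dot c' x = dot c (x - t x *: a).
    by rewrite dotBl dotZl dotBr dotZr /t; field.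
  rewrite -c'E; apply: dual => i; case: (unliftP ord0 i) => [j|] ->.
    by rewrite c'E; apply: cu.
  by rewrite dotBl dotZl -/a -/s divfK // subrr.
exists (fun i => if unlift ord0 i is Some j then w j else
  t d - \sum_j w j * t (u (fintype.lift ord0 j))); split.
  move=> i; case: unliftP => // _; rewrite subr_ge0.
  apply: (@le_trans _ _ 0); last by rewrite divr_ge0 ?ltW.
  apply: sumr_le0 => j _; rewrite mulr_ge0_le0 // /t.
  by rewrite pmulr_lle0 ?invr_gt0.
rewrite big_ord_recl unlift_none -/a.
under [X in _ + X]eq_bigr do rewrite liftK.
move/eqP: dE; rewrite subr_eq => /eqP {1}->.
under [X in X + _ = _]eq_bigr do rewrite scalerBr scalerA.
by rewrite sumrB scalerBl -scaler_suml addrC -addrA; congr (_ + _); rewrite addrC.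
Qed.

Section ConvexHull.
Variables (R : realType) (n : nat).
Implicit Types (c x y p : 'rV[R]_n) (A F s P : set 'rV[R]_n).

(** The hull of the points is the slice at height 1 of the cone that they generate. *)
Lemma conv_hullP k (p : 'I_k -> 'rV[R]_n) x : conv_hull p x <->
  forall c b, (forall i, dot c (p i) <= b) -> dot c x <= b.
Proof.
split=> [[w [w0 w1 ->]] c b cp|dual].
  rewrite dot_sumr -[leRHS]mul1r -w1 mulr_suml; apply: ler_sum => i _.
  by rewrite dotZr ler_wpM2l.
have [e|w [w0 E]] := @farkas R (n + 1) k (fun i => row_mx (p i) 1%:M) (row_mx x 1%:M).
  rewrite -(hsubmxK e) (mx11_scalar (rsubmx e)) => ep.
  rewrite dot_row_mx mulr1 -lerBrDr sub0r; apply: dual => i.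
  by have := ep i; rewrite dot_row_mx mulr1 -lerBrDr sub0r.
exists w; split=> //.
  have := congr1 (fun z : 'rV[R]_(n + 1) => rsubmx z 0 0) E.
  rewrite row_mxKr mxE eqxx mulr1n linear_sum summxE => ->.
  by apply: eq_bigr => i _; rewrite linearZ /= row_mxKr !mxE mulr1.
have := congr1 (@lsubmx R 1 n 1) E; rewrite row_mxKl linear_sum => ->.
by apply: eq_bigr => i _; rewrite linearZ /= row_mxKl.
Qed.

Lemma conv_hull_gen k (p : 'I_k -> 'rV[R]_n) i : conv_hull p (p i).
Proof. by apply/conv_hullP => c b; apply. Qed.

Definition convex A := forall x y a, A x -> A y -> 0 <= a <= 1 ->
  A (a *: x + (1 - a) *: y).

(** The form of the duality that does not mention generators. *)
Lemma polytope_dual P : polytope P -> forall x,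
  (forall c b, (forall y, P y -> dot c y <= b) -> dot c x <= b) -> P x.
Proof.
move=> [k [p ->]] x dual; apply/conv_hullP => c b cp; apply: dual => y.
by move/conv_hullP; apply.
Qed.

Lemma polytope_convex P : polytope P -> convex P.
Proof.
move=> PP x y a Px Py /andP[a0 a1]; apply: (polytope_dual PP) => c b cP.
rewrite dotDr !dotZr; have := cP _ Px; have := cP _ Py; nra.
Qed.

End ConvexHull.

(** * Vertices, faces and dimension of polytopes *)

Section Polytopes.
Variables (R : realType) (n : nat).
Implicit Types (c x y z p : 'rV[R]_n) (b : R) (A F s P : set 'rV[R]_n).

Definition valid s c b := forall x, s x -> dot c x <= b.

Lemma faces_refl s : s !=set0 -> faces s s.
Proof.
move=> s0; split=> //; exists 0, 0; split=> [x _|]; first by rewrite dot0l.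
by rewrite predeqE => x; split=> [sx|[]//]; split=> //=; rewrite dot0l.
Qed.

Lemma face_sub s F : faces s F -> F `<=` s.
Proof. by move=> [_ [c [b [_ ->]]]] x []. Qed.

Lemma verts_in s v : verts (faces s) v -> s v.
Proof. by move=> /face_sub; apply. Qed.

(** A generator in the hull of the others can be dropped. Once none is left, the
duality separates each generator strictly from the others, and the separating
functional exposes it as a vertex. *)
Lemma polytope_verts s : polytope s -> exists k (p : 'I_k -> 'rV[R]_n),
  (forall i, verts (faces s) (p i)) /\ s = conv_hull p.
Proof.
move=> [k [p ->]]; elim: k p => [|k IHk] p.
  by exists 0%N, p; split=> // -[].
have [[j pj]|/forallNP irr] := pselect (exists j, conv_hull (p \o fintype.lift j) (p j)).
  suff -> : conv_hull p = conv_hull (p \o fintype.lift j) by apply: IHk.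
  rewrite predeqE => x; split=> /conv_hullP xp; apply/conv_hullP => c b cp.
    apply: xp => i; case: (unliftP j i) => [i'|] ->; first exact: cp.
    by move/conv_hullP: pj; apply.
  by apply: xp => i; apply: cp.
exists k.+1, p; split=> // j.
have [c [b [cp cpj]]] : exists c b,
    (forall i, dot c (p (fintype.lift j i)) <= b) /\ b < dot c (p j).
  apply: contra_notP (irr j) => nocb; apply/conv_hullP => c b cp.
  by rewrite leNgt; apply/negP => cpj; apply: nocb; exists c, b.
have cpi i : i != j -> dot c (p i) < dot c (p j).
  by case: (unliftP j i) => [i'|] ->; rewrite ?eqxx // => _; apply: le_lt_trans (cp i') _.
have cle i : dot c (p i) <= dot c (p j).
  by have [->|/cpi/ltW] := eqVneq i j.
split; first by exists (p j).
exists c, (dot c (p j)); split.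
  by move=> x /conv_hullP; apply.
rewrite predeqE => x; split=> [->|[[w [w0 w1 xE]] /= cx]].
  by split=> //; apply: conv_hull_gen.
(* A point of the hull where c is maximal puts no weight on the other
   generators. *)
have : \sum_i w i * (dot c (p j) - dot c (p i)) = 0.
  under eq_bigr do rewrite mulrBr.
  rewrite sumrB -mulr_suml w1 mul1r -cx {1}xE dot_sumr; apply/eqP.
  by rewrite subr_eq0; apply/eqP; apply: eq_bigr => i _; rewrite dotZr.
move/eqP; rewrite psumr_eq0 => [/allP w_eq0|i _]; last first.
  by rewrite mulr_ge0 // subr_ge0.
have {}w_eq0 i : i != j -> w i = 0.
  move=> ij; have /implyP := w_eq0 i (mem_index_enum i).
  move/(_ isT); rewrite mulf_eq0 => /orP[/eqP//|].
  by rewrite subr_eq0 => /eqP cE; move: (cpi i ij); rewrite cE ltxx.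
have wj : w j = 1.
  by rewrite -w1 (bigD1 j) //= big1 ?addr0 // => i; apply: w_eq0.
rewrite /= xE (bigD1 j) //= big1 ?addr0 ?wj ?scale1r // => i ij.
by rewrite w_eq0 // scale0r.
Qed.

Lemma polytope_valid s c b : polytope s ->
  (forall v, verts (faces s) v -> dot c v <= b) -> valid s c b.
Proof.
move=> /polytope_verts[k [p [pv sE]]] cv x; rewrite sE => /conv_hullP; apply=> i.
exact/cv/pv.
Qed.

Lemma polytope_vertex s : polytope s -> s !=set0 -> verts (faces s) !=set0.
Proof.
move=> /polytope_verts[[|k] [p [pv sE]]] [x]; last by exists (p ord0).
rewrite {1}sE => -[w [_ /eqP]]; rewrite big_ord0 eq_sym.
by rewrite (negPf (oner_neq0 _)).
Qed.

(** If y - p were in the cone of the vectors q_i - y over the generators q_i, a small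
step from y along y - p would stay in the hull. So the Farkas lemma gives a
functional that is maximal at y over the polytope and increases from p to y. *)
Lemma boundary_point s p y : polytope s -> s p -> s y ->
  (forall e, 0 < e -> ~ s (y + e *: (y - p))) ->
  exists c b, [/\ valid s c b, dot c p < b & dot c y = b].
Proof.
move=> sP sp sy bd; have [k [q sE]] := sP.
suff [c [cq cd]] : exists c, (forall i, dot c (q i - y) <= 0) /\ 0 < dot c (y - p).
  exists c, (dot c y); split=> //; last by rewrite -subr_gt0 -dotBr.
  move=> x; rewrite sE => /conv_hullP; apply=> i.
  by rewrite -subr_le0 -dotBr.
apply: contrapT => noc.
have [|w [w0 dE]] := @farkas R n k (fun i => q i - y) (y - p).
  by move=> c cq; rewrite leNgt; apply/negP => cd; apply: noc; exists c.
set L := \sum_i w i; have L0 : 0 <= L by apply: sumr_ge0.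
apply: (bd (1 + L)^-1); first by rewrite invr_gt0 ltr_wpDr.
apply: (polytope_dual sP) => c b cs.
have cy := cs _ sy.
have cd : dot c (y - p) <= L * (b - dot c y).
  rewrite dE dot_sumr /L mulr_suml; apply: ler_sum => i _.
  rewrite dotZr ler_wpM2l // dotBr lerB // cs // sE; exact: conv_hull_gen.
rewrite dotDr dotZr -lerBrDl ler_pdivrMl ?ltr_wpDr //.
apply: (le_trans cd); rewrite mulrDl mul1r lerDr subr_ge0 //.
Qed.

Lemma polytope_dot_bounded s c : polytope s -> exists b, valid s c b.
Proof.
move=> [k [p ->]]; exists (\sum_i `|dot c (p i)|) => x /conv_hullP; apply=> i.
rewrite (bigD1 i) //= (le_trans (ler_norm _)) // lerDl.
by apply: sumr_ge0 => j _; apply: normr_ge0.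
Qed.

(** The parameters t for which the ray is in the polytope form a bounded set, and the
set of valid inequalities keeps its supremum in it. *)
Lemma ray_exit s p x : polytope s -> s p -> s x -> x != p ->
  exists2 t, 1 <= t & s (p + t *: (x - p)) /\
    forall e, 0 < e -> ~ s (p + (t + e) *: (x - p)).
Proof.
move=> sP sp sx xp; have [b cs] := polytope_dot_bounded (x - p) sP.
pose E : set R := [set t | s (p + t *: (x - p))].
have E1 : E 1 by rewrite /E /= scale1r addrC subrK.
have Eb c' b' : valid s c' b' -> 0 < dot c' (x - p) ->
    ubound E ((b' - dot c' p) / dot c' (x - p)).
  move=> cs' cd t /cs'; rewrite dotDr dotZr -lerBrDl => ?.
  by rewrite ler_pdivlMr.
have Esup : has_sup E.
  by split; [exists 1 | eexists; apply: (Eb _ _ cs); rewrite dot_self_gt0 // subr_eq0].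
exists (sup E); first exact: (ub_le_sup Esup.2).
split.
  apply: (polytope_dual sP) => c' b' cs'; rewrite dotDr dotZr -lerBrDl.
  have [cd|cd] := ltP 0 (dot c' (x - p)).
    by rewrite -ler_pdivlMr //; apply: (ge_sup Esup.1); apply: Eb.
  apply: (@le_trans _ _ 0); last by rewrite subr_ge0 cs'.
  rewrite mulr_ge0_le0 // (le_trans ler01) //; exact: (ub_le_sup Esup.2).
move=> e e0 Ee; have : sup E + e <= sup E by exact: (ub_le_sup Esup.2).
by rewrite gerDl leNgt e0.
Qed.

Lemma le_affdim A k x (M : 'M_(k, n)) : A x -> (forall i, A (x + row i M)) ->
  row_free M -> (k <= affdim A)%N.
Proof.
move=> Ax AM fM; have kn : (k < n.+1)%N.
  by rewrite ltnS; move: fM; rewrite /row_free => /eqP <-; apply: rank_leq_col.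
apply: (@leq_bigmax_cond _ _ _ (Ordinal kn)); apply/asboolP.
by exists x, M.
Qed.

Lemma affdim_frame A : A !=set0 -> exists x (M : 'M_(affdim A, n)),
  [/\ A x, forall i, A (x + row i M) & row_free M].
Proof.
move=> [x Ax]; pose Q (k : 'I_n.+1) := `[< exists x (M : 'M_(k, n)),
  [/\ A x, forall i, A (x + row i M) & row_free M] >].

have Q0 : Q ord0.
  apply/asboolP; exists x, (0 : 'M_(0, n)); split=> //; first by case.
  by rewrite /row_free mxrank0.
have [k Qk kE] : {k : 'I_n.+1 | Q k & affdim A = k}.
  by apply: eq_bigmax_cond; apply/card_gt0P; exists ord0.
by rewrite kE; move/asboolP: Qk.
Qed.

(** A point off the hyperplane of the face extends any affine frame of the face. *)
Lemma affdim_hyperplane s c b z : valid s c b -> s z -> dot c z < b ->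
  (s `&` [set x | dot c x = b]) !=set0 ->
  (affdim (s `&` [set x | dot c x = b]) < affdim s)%N.
Proof.
move=> cs sz cz /affdim_frame[x [M [[sx /= cx] FM fM]]].
rewrite -addn1; apply: (@le_affdim _ _ x (col_mx M (z - x))) => //.
  move=> i; rewrite -(fintype.splitK i); case: (fintype.split i) => j /=.
    by rewrite rowKu; case: (FM j).
  by rewrite rowKd row_id addrC subrK.
have cM : M *m c^T = 0.
  apply/colP => i; rewrite !mxE; case: (FM i) => _ /= /eqP.
  rewrite dotDr cx -subr_eq0 addrAC subrr add0r => /eqP.
  by apply: etrans; apply: eq_bigr => j _; rewrite !mxE mulrC.
apply: inj_row_free => v; rewrite -(hsubmxK v) mul_row_col => v0.
have /eqP : rsubmx v 0 0 * dot c (z - x) = 0.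
  have := congr1 (fun w => (w *m c^T) 0 0) v0.
  rewrite mulmxDl -!mulmxA cM mulmx0 add0r mul0mx mxE big_ord1 [RHS]mxE => <-.
  congr (_ * _); rewrite [RHS]mxE; apply: eq_bigr => j _.
  by rewrite [c^T _ _]mxE mulrC.
rewrite mulf_eq0 dotBr cx subr_eq0 (lt_eqF cz) orbF => /eqP rv.
have rv0 : rsubmx v = 0 by apply/matrixP => i j; rewrite !ord1 rv mxE.
rewrite rv0 mul0mx addr0 in v0.
by rewrite rv0 (row_free_inj fM (etrans v0 (esym (mul0mx _ _)))) row_mx0.
Qed.

Lemma affdim_face s F : faces s F -> F <> s -> (affdim F < affdim s)%N.
Proof.
move=> [F0 [c [b [cs FE]]]] Fs.
have [z sz cz] : exists2 z, s z & dot c z < b.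
  apply: contrapT => noz; apply: Fs; rewrite FE predeqE => x; split=> [[]//|sx].
  split=> //=; apply/eqP; rewrite eq_le cs // leNgt; apply/negP => cx.
  by apply: noz; exists x.
by rewrite FE; apply: (affdim_hyperplane cs sz cz); rewrite -FE.
Qed.

End Polytopes.

Section Average.
Variables (R : realType) (n : nat) (I : finType) (q : I -> 'rV[R]_n).

Definition average : 'rV[R]_n := #|I|%:R^-1 *: \sum_i q i.

Lemma dot_average_le c b : (0 < #|I|)%N -> (forall i, dot c (q i) <= b) ->
  dot c average <= b.
Proof.
move=> I0 cq; rewrite dotZr ler_pdivrMl ?ltr0n // mulr_natl.
by rewrite dot_sumr -sumr_const ler_sum.
Qed.

Lemma dot_average_lt c b i0 : (forall i, dot c (q i) <= b) ->
  dot c (q i0) < b -> dot c average < b.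
Proof.
move=> cq cq0; have I0 : (0 < #|I|)%N by apply/card_gt0P; exists i0.
rewrite dotZr ltr_pdivrMl ?ltr0n // mulr_natl.
rewrite dot_sumr -sumr_const (bigD1 i0) //= [ltRHS](bigD1 i0) //=.
by apply: ltr_leD => //; apply: ler_sum.
Qed.

End Average.

(** * Linear extension to chains, and relative continuity *)

Section FreeLift.
Variables (K : fieldType) (S : choiceType) (M : lmodType K).
Implicit Types (f g : S -> M) (c : {freeg S / K}).

(** Every fact on the linear extension of a map to chains is read off this sum. *)
Lemma fglift_sum f c : fglift f c = \sum_(s <- dom c) coeff s c *: f s.
Proof. by rewrite -[in LHS](Freeg_dom c) fglift_Freeg /prelift big_map. Qed.

Lemma fgliftB f c c' : fglift f (c - c') = fglift f c - fglift f c'.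
Proof. exact: lift_is_additive. Qed.

Lemma fglift0 f : fglift f 0 = 0.
Proof. by rewrite fglift_sum dom0 big_nil. Qed.

Lemma fgliftD f c c' : fglift f (c + c') = fglift f c + fglift f c'.
Proof.
have fgliftN : fglift f (- c') = - fglift f c'.
  by rewrite -sub0r fgliftB fglift0 sub0r.
by rewrite -{1}[c']opprK fgliftB fgliftN opprK.
Qed.

Lemma fglift_bigsum f I (r : seq I) (F : I -> {freeg S / K}) :
  fglift f (\sum_(i <- r) F i) = \sum_(i <- r) fglift f (F i).
Proof. exact: (big_morph (fglift f) (fgliftD f) (fglift0 f)). Qed.

Lemma fgliftZ f a c : fglift f (a *: c) = a *: fglift f c.
Proof.
rewrite -[c]freeg_sumE scaler_sumr !fglift_bigsum scaler_sumr.
apply: eq_bigr => s _.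
have -> : a *: << coeff s c *g s >> = << a * coeff s c *g s >>.
  by apply/eqP/freeg_eqP => s'; rewrite coeffZ !coeffU mulrA.
by rewrite !liftU scalerA.
Qed.

Lemma eq_in_fglift f g c : {in dom c, f =1 g} -> fglift f c = fglift g c.
Proof. by move=> fg; rewrite !fglift_sum; apply: eq_big_seq => s /fg ->. Qed.

Lemma fglift_subf f g c :
  fglift (fun s => f s - g s) c = fglift f c - fglift g c.
Proof. by rewrite !fglift_sum -sumrB; apply: eq_bigr => s _; rewrite scalerBr. Qed.

End FreeLift.

Lemma fglift_id (K : fieldType) (S : choiceType) (c : {freeg S / K}) :
  fglift (fun s => << s >>) c = c.
Proof.
rewrite fglift_sum -[RHS]freeg_sumE; apply: eq_bigr => s _.
by apply/eqP/freeg_eqP => s'; rewrite coeffZ !coeffU mul1r.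
Qed.

Lemma fglift_comp (K : fieldType) (S T : choiceType) (M : lmodType K)
    (f : S -> {freeg T / K}) (g : T -> M) (c : {freeg S / K}) :
  fglift g (fglift f c) = fglift (fun s => fglift g (f s)) c.
Proof.
rewrite [fglift f c]fglift_sum [RHS]fglift_sum fglift_bigsum.
by apply: eq_bigr => s _; rewrite fgliftZ.
Qed.

Lemma dom_fglift (K : fieldType) (S T : choiceType) (f : S -> T)
    (c : {freeg S / K}) t :
  t \in dom (fglift (fun s => << f s >> : {freeg T / K}) c) ->
  exists2 s, s \in dom c & t = f s.
Proof.
rewrite fglift_sum => /dom_sum_subset /flattenP[d /mapP[s]].
rewrite mem_filter /= => sc -> /domZ_subset; rewrite domU1 inE => /eqP ->.
by exists s.
Qed.

Section Topology.
Variable R : realType.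

Lemma cvg_row (T : Type) (F : set_system T) (FF : Filter F) n
    (f : T -> 'rV[R]_n) (x : 'rV[R]_n) :
  (forall i, (fun t => f t 0 i) @ F --> x 0 i) -> f @ F --> x.
Proof.
move=> fx A [P Px PA].
have : \forall t \near F, forall i, P 0 i (f t 0 i).
  by apply: filter_forall => i; apply: fx; apply: Px.
by apply: filterS => t Pt; apply: PA => i j; rewrite ord1; apply: Pt.
Qed.

Lemma dot_continuous n (c : 'rV[R]_n) : continuous (dot c).
Proof.
have cx (i : 'I_n) : true -> continuous (fun x : 'rV[R]_n => c 0 i * x 0 i).
  move=> _ x; apply: (@cvgM R _ (nbhs x) _ (fun=> c 0 i) (fun x : 'rV[R]_n => x 0 i)).
    exact: cvg_cst.
  exact: coord_continuous.
exact: (@continuous_big R 'I_n +%R 0 xpredT (@add_continuous R) _ (index_enum _) _ cx).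
Qed.

Lemma cvg_within_at (T U : topologicalType) (A : set T) (f : T -> U) x :
  {for x, continuous f} -> f @ within A (nbhs x) --> f x.
Proof.
by move=> fx; apply: (cvg_trans _ fx); apply: cvg_fmap2; apply: cvg_within.
Qed.

Lemma cvg_within_comp (T U V : topologicalType) (A : set T) (B : set U)
    (f : T -> U) (g : U -> V) x :
  f @ within A (nbhs x) --> f x -> (\forall y \near within A (nbhs x), B (f y)) ->
  g @ within B (nbhs (f x)) --> g (f x) -> (g \o f) @ within A (nbhs x) --> g (f x).
Proof.
move=> fx fB gx W /gx /= gW.
have {}gW : \forall y \near within A (nbhs x), B (f y) -> W (g (f y)).
  exact: (fx [set y | B y -> W (g y)] gW).
by apply: filterS2 fB gW => y By; apply.
Qed.

Lemma within_comp (T U V : topologicalType) (A : set T) (B : set U)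
    (f : T -> U) (g : U -> V) :
  {within A, continuous f} -> (forall x, A x -> B (f x)) ->
  {within B, continuous g} -> {within A, continuous (g \o f)}.
Proof.
move=> /subspace_continuousP fc fAB /subspace_continuousP gc.
apply/subspace_continuousP => x Ax; apply: cvg_within_comp (fc x Ax) _ (gc _ (fAB _ Ax)).
by apply: (@filterE _ (nbhs x)) => y; apply: fAB.
Qed.

Lemma eq_within (T U : topologicalType) (A : set T) (f g : T -> U) :
  (forall x, A x -> f x = g x) -> {within A, continuous f} ->
  {within A, continuous g}.
Proof.
move=> fg; apply: subspace_eq_continuous => x; rewrite inE => Ax.
exact: fg.
Qed.

End Topology.

(** * Singular chains and retracts *)

Section SingularSimplices.
Variables (R : realType) (n : nat).
Implicit Types (k : nat) (U V : set 'rV[R]_n).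

Lemma patch_std k (g : 'rV[R]_k.+1 -> 'rV[R]_n) t : @std_simplex R k t ->
  patch (fun=> 0) (@std_simplex R k) g t = g t.
Proof. by move=> St; rewrite /patch mem_set. Qed.

Lemma patch_nstd k (g : 'rV[R]_k.+1 -> 'rV[R]_n) t : ~ @std_simplex R k t ->
  patch (fun=> 0) (@std_simplex R k) g t = 0.
Proof. by move=> St; rewrite /patch memNset. Qed.

Lemma coface_std k (i : 'I_k.+2) (t : 'rV[R]_k.+1) :
  @std_simplex R k t -> @std_simplex R k.+1 (coface i t).
Proof.
move=> [t0 t1]; split=> [j|]; first by rewrite mxE; case: unliftP.
rewrite (bigD1_ord i) //= !mxE unlift_none add0r -t1.
by apply: eq_bigr => j _; rewrite mxE liftK.
Qed.

Lemma simplex_patch k U (g : 'rV[R]_k.+1 -> 'rV[R]_n) :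
  {within @std_simplex R k, continuous g} ->
  (forall t, @std_simplex R k t -> U (g t)) ->
  singular_simplex U (patch (fun=> 0) (@std_simplex R k) g).
Proof.
move=> gc gU; split.
- by apply: eq_within gc => t St; rewrite patch_std.
- by move=> t St; rewrite patch_std //; apply: gU.
- by move=> t St; rewrite patch_nstd.
Qed.

(** Composition with r, set to zero outside the standard simplex so that the faces
of the image are literally the images of the faces. *)
Definition push (r : 'rV[R]_n -> 'rV[R]_n) k (s : 'rV[R]_k.+1 -> 'rV[R]_n) :=
  patch (fun=> 0) (@std_simplex R k) (r \o s).

Lemma push_singular r U V k (s : 'rV[R]_k.+1 -> 'rV[R]_n) :
  {within U, continuous r} -> (forall x, U x -> V (r x)) ->
  singular_simplex U s -> singular_simplex V (push r s).
Proof.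
move=> rc rUV [sc sU _]; apply: simplex_patch => [|t /sU /rUV //].
exact: within_comp sc sU rc.
Qed.

Lemma push_id r U k (s : 'rV[R]_k.+1 -> 'rV[R]_n) :
  (forall x, U x -> r x = x) -> singular_simplex U s -> push r s = s.
Proof.
move=> rU [_ sU s0]; apply/funext => t.
have [St|St] := pselect (std_simplex t); last by rewrite /push patch_nstd // s0.
by rewrite /push patch_std //= rU //; apply: sU.
Qed.

Lemma simplex_face_push r k i (s : 'rV[R]_k.+2 -> 'rV[R]_n) :
  simplex_face i (push r s) = push r (simplex_face i s).
Proof.
apply/funext => t; rewrite /simplex_face /push.
have [St|St] := pselect (std_simplex t); last by rewrite !patch_nstd.
by rewrite !patch_std //= !patch_std //; apply: coface_std.
Qed.

End SingularSimplices.

Section SingularChains.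
Variables (R : realType) (K : fieldType) (n : nat).
Implicit Types (k : nat) (U V : set 'rV[R]_n).
Local Notation chain k := (chain R K n k).
Local Notation simplex k := ('rV[R]_k.+1 -> 'rV[R]_n).

Definition chain_map k k' (f : simplex k -> simplex k') (c : chain k) : chain k' :=
  fglift (fun s => << f s >> : chain k') c.

Lemma chain_map_singular k k' (f : simplex k -> simplex k') U V (c : chain k) :
  (forall s, singular_simplex U s -> singular_simplex V (f s)) ->
  singular_chain U c -> singular_chain V (chain_map f c).
Proof. by move=> fUV cU t /dom_fglift[s /cU sU ->]; apply: fUV. Qed.

Lemma boundaryU k (s : simplex k.+1) : boundary (<< s >> : chain k.+1) =
  \sum_(i < k.+2) (-1) ^+ i *: (<< simplex_face i s >> : chain k).
Proof. by rewrite /boundary liftU scale1r. Qed.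

Lemma boundary_chain_map k k' (f : simplex k -> simplex k'.+1) (c : chain k) :
  boundary (chain_map f c) =
  fglift (fun s => \sum_(i < k'.+2) (-1) ^+ i *: << simplex_face i (f s) >>) c.
Proof.
rewrite /boundary /chain_map fglift_comp; congr fglift; apply/funext => s.
exact: boundaryU.
Qed.

Lemma chain_map_boundary k k' (f : simplex k -> simplex k') (c : chain k.+1) :
  chain_map f (boundary c) =
  fglift (fun s => \sum_(i < k.+2) (-1) ^+ i *: << f (simplex_face i s) >>) c.
Proof.
rewrite /boundary /chain_map fglift_comp; congr fglift; apply/funext => s.
by rewrite fglift_bigsum; apply: eq_bigr => i _; rewrite fgliftZ liftU scale1r.
Qed.

Lemma boundary_push r k (c : chain k.+1) :
  boundary (chain_map (@push R n r k.+1) c) = chain_map (@push R n r k) (boundary c).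
Proof.
rewrite boundary_chain_map chain_map_boundary; congr fglift; apply/funext => s.
by apply: eq_bigr => i _; rewrite simplex_face_push.
Qed.

Lemma chain_push_id r U k (c : chain k) : (forall x, U x -> r x = x) ->
  singular_chain U c -> chain_map (@push R n r k) c = c.
Proof.
move=> rU cU; rewrite -[RHS]fglift_id; apply: eq_in_fglift => s /cU sU.
by rewrite (push_id rU sU).
Qed.

Definition retract U V := exists r : 'rV[R]_n -> 'rV[R]_n,
  [/\ {within U, continuous r}, forall x, U x -> V (r x) & forall x, V x -> r x = x].

Lemma singular_chain_sub U V k (c : chain k) : U `<=` V ->
  singular_chain U c -> singular_chain V c.
Proof. by move=> UV cU s /cU[sc sU s0]; split=> // t /sU /UV. Qed.

(** A cycle in V bounds a chain in U; its image under the retraction has the same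
boundary, because the retraction fixes the simplices of the cycle. *)
Lemma acyclic_retract U V : V `<=` U -> retract U V -> acyclic K U -> acyclic K V.
Proof.
move=> VU [r [rc rUV rV]] [[x Ux] H0 Hk].
have pushV k (b : chain k) : singular_chain U b ->
    singular_chain V (chain_map (@push R n r k) b).
  by apply: chain_map_singular => s; apply: push_singular.
split; first by exists (r x); apply: rUV.
- move=> c cV /H0[|b [bU bc]]; first exact: singular_chain_sub cV.
  exists (chain_map (@push R n r 1) b); split; first exact: pushV.
  by rewrite boundary_push bc (chain_push_id rV).
- move=> k c cV /Hk[|b [bU bc]]; first exact: singular_chain_sub cV.
  exists (chain_map (@push R n r k.+2) b); split; first exact: pushV.
  by rewrite boundary_push bc (chain_push_id rV).
Qed.

End SingularChains.

Section StdSimplex.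
Variable R : realType.

Lemma std_simplex_le1 k t i : @std_simplex R k t -> t 0 i <= 1.
Proof.
by move=> [t0 <-]; rewrite (bigD1 i) //= lerDl sumr_ge0.
Qed.

Lemma std_simplex_compact k : compact (@std_simplex R k).
Proof.
apply: bounded_closed_compact.
  exists 1; split=> // C C1 t St; rewrite /= /Num.norm /= mx_normrE.
  apply: bigmax_le => [|[i j] _ /=]; first by rewrite ltW // (lt_trans _ C1).
  rewrite ord1 ger0_norm; last by case: St.
  by rewrite (le_trans (std_simplex_le1 j St)) // ltW.
rewrite (_ : @std_simplex R k = (\bigcap_i [set t : 'rV[R]_k.+1 | 0 <= t 0 i]) `&`
    [set t | dot (const_mx 1) t = 1]); last first.
  rewrite predeqE => t; rewrite /dot /=.
  under [X in _ <-> _ /\ X = 1]eq_bigr do rewrite mxE mul1r.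
  by split=> -[t0 t1]; split=> // i; [move=> _; apply: t0 | apply: (t0 i)].
apply: closedI.
  apply: closed_bigI => i _.
  apply: (@preimage_closed _ _ (fun t : 'rV[R]_k.+1 => t 0 i) [set x | 0 <= x]).
    by move=> t _; apply: coord_continuous.
  exact: closed_ge.
apply: (@preimage_closed _ _ (dot (const_mx 1)) [set x | x = 1]).
  by move=> t _; apply: dot_continuous.
exact: closed_eq.
Qed.

End StdSimplex.

(** * Acyclicity of convex sets *)

Section Cone.
Variables (R : realType) (K : fieldType) (n : nat) (U : set 'rV[R]_n) (p : 'rV[R]_n).
Hypothesis starU : forall x a, U x -> 0 <= a <= 1 -> U (a *: p + (1 - a) *: x).
Hypothesis Up : U p.
Implicit Types k : nat.
Local Notation chain k := (chain R K n k).
Local Notation simplex k := ('rV[R]_k.+1 -> 'rV[R]_n).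

Definition tail k (t : 'rV[R]_k.+2) : 'rV[R]_k.+1 :=
  \row_j t 0 (fintype.lift ord0 j).

(** The point of the base from which the join with the apex passes through t; at the
apex itself, where the inverse is that of 0, it carries weight 0 in the cone. *)
Definition base_point k (t : 'rV[R]_k.+2) := (1 - t 0 ord0)^-1 *: tail t.

Definition cone_point k (s : simplex k) (t : 'rV[R]_k.+2) : 'rV[R]_n :=
  t 0 ord0 *: p + (1 - t 0 ord0) *: s (base_point t).

Definition cone k (s : simplex k) : simplex k.+1 :=
  patch (fun=> 0) (@std_simplex R k.+1) (cone_point s).

Lemma base_point_std k (t : 'rV[R]_k.+2) :
  @std_simplex R k.+1 t -> t 0 ord0 != 1 -> @std_simplex R k (base_point t).
Proof.
move=> St t1; have lt1 : 0 < 1 - t 0 ord0.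
  by rewrite subr_gt0 lt_neqAle t1 (std_simplex_le1 _ St).
case: St => t_ge0 sum_t; split=> [i|].
  by rewrite !mxE mulr_ge0 // invr_ge0 ltW.
under eq_bigr do rewrite !mxE.
rewrite -mulr_sumr; apply: (@mulfI _ (1 - t 0 ord0)); first by rewrite gt_eqF.
rewrite mulrA mulfV ?gt_eqF // mul1r mulr1 -[X in X - _]sum_t [in RHS]big_ord_recl.
by rewrite addrC addKr.
Qed.

Lemma coface_lift0 k (i : 'I_k.+1) (t : 'rV[R]_k.+1) :
  coface (fintype.lift ord0 i) t 0 ord0 = t 0 ord0.
Proof.
rewrite mxE (_ : ord0 = fintype.lift (fintype.lift ord0 i) ord0) ?liftK //.
exact: val_inj.
Qed.

Lemma tail_coface0 k (t : 'rV[R]_k.+1) : tail (coface ord0 t) = t.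
Proof. by apply/rowP => j; rewrite !mxE liftK. Qed.

Lemma tail_coface k (i : 'I_k.+2) (t : 'rV[R]_k.+2) :
  tail (coface (fintype.lift ord0 i) t) = coface i (tail t).
Proof.
apply/rowP => j; rewrite !mxE; case: (unliftP i j) => [j'|] ->.
  rewrite (_ : fintype.lift ord0 (fintype.lift i j') =
    fintype.lift (fintype.lift ord0 i) (fintype.lift ord0 j')).
    by rewrite liftK mxE.
  by apply: val_inj; rewrite /= /bump /= !add1n ltnS addnS.
by rewrite unlift_none.
Qed.

Lemma cofaceZ k i a (t : 'rV[R]_k.+1) : coface i (a *: t) = a *: coface i t.
Proof.
by apply/rowP => j; rewrite !mxE; case: unliftP => [j'|] _; rewrite ?mxE ?mulr0.
Qed.

Lemma simplex_face_cone0 k (s : simplex k) :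
  singular_simplex U s -> simplex_face ord0 (cone s) = s.
Proof.
move=> [_ _ s0]; apply/funext => t; rewrite /simplex_face.
have [St|St] := pselect (std_simplex t); last by rewrite patch_nstd // s0.
rewrite patch_std //= /cone patch_std; last exact: coface_std.
rewrite /cone_point /base_point tail_coface0.
by rewrite mxE unlift_none subr0 invr1 !scale1r scale0r add0r.
Qed.

Lemma simplex_face_coneS k (i : 'I_k.+2) (s : simplex k.+1) :
  simplex_face (fintype.lift ord0 i) (cone s) = cone (simplex_face i s).
Proof.
apply/funext => t; rewrite /simplex_face /cone.
have [St|St] := pselect (std_simplex t); last by rewrite !patch_nstd.
rewrite !patch_std //= patch_std; last exact: coface_std.
rewrite /cone_point coface_lift0; congr (_ + _).
have [t1|t1] := eqVneq (t 0 ord0) 1; first by rewrite t1 subrr !scale0r.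
rewrite patch_std; last exact: base_point_std.
by rewrite /= /base_point coface_lift0 tail_coface cofaceZ.
Qed.

Definition apex_simplex : simplex 0 := patch (fun=> 0) (@std_simplex R 0) (fun=> p).

Lemma simplex_face_cone1 (s : simplex 0) :
  simplex_face (fintype.lift ord0 ord0) (cone s) = apex_simplex.
Proof.
apply/funext => t; rewrite /simplex_face /apex_simplex.
have [St|St] := pselect (std_simplex t); last by rewrite !patch_nstd.
rewrite !patch_std //= /cone patch_std; last exact: coface_std.
have t1 : t 0 ord0 = 1 by case: St => _; rewrite big_ord1.
by rewrite /cone_point coface_lift0 t1 subrr scale0r scale1r addr0.
Qed.

Lemma cvg_tail k (t : 'rV[R]_k.+2) : {for t, continuous (@tail k)}.
Proof.
apply: (@cvg_row R _ (nbhs t) _ _ (@tail k)) => i; rewrite mxE.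
under eq_fun do rewrite mxE.
exact: coord_continuous.
Qed.

(** Away from the apex the formula is a composite of continuous maps. At the apex
the base point has no limit, but the simplex has a bounded image, as the standard
simplex is compact, and its weight tends to 0. *)
Lemma cone_point_continuous k (s : simplex k) : singular_simplex U s ->
  {within @std_simplex R k.+1, continuous (cone_point s)}.
Proof.
move=> [sc sU _]; apply/subspace_continuousP => t St; rewrite /from_subspace.
have t0c : (fun t : 'rV[R]_k.+2 => t 0 ord0) @ within (@std_simplex R k.+1) (nbhs t)
    --> t 0 ord0 by apply: cvg_within_at; apply: coord_continuous.
have t1c : (fun t : 'rV[R]_k.+2 => 1 - t 0 ord0) @
    within (@std_simplex R k.+1) (nbhs t) --> 1 - t 0 ord0.
  by apply: cvgB => //; apply: cvg_cst.
have [t1|t1] := eqVneq (t 0 ord0) 1.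
  have [C [_ sC]] := compact_bounded (continuous_compact sc (@std_simplex_compact R k)).
  pose D := `|p| + (`|C| + 1).
  have D0 : 0 < D by rewrite ltr_wpDl // ltr_wpDl.
  have pE : cone_point s t = p.
    by rewrite /cone_point t1 subrr scale0r scale1r addr0.
  rewrite pE; apply/cvgrPdist_le => e e0.
  have : within (@std_simplex R k.+1) (nbhs t) [set t' : 'rV[R]_k.+2 |
      `|(1 - t 0 ord0) - (1 - t' 0 ord0)| <= e / D].
    by move/cvgrPdist_le: t1c; apply; rewrite divr_gt0.
  rewrite t1 subrr; apply: filterS2 (withinT _ (nbhs_filter t)) => t' St' /=.
  rewrite sub0r normrN => t'e.
  have -> : p - cone_point s t' = (1 - t' 0 ord0) *: (p - s (base_point t')).
    by rewrite [RHS]scalerBr [X in _ = X - _]scalerBl scale1r /cone_point opprD addrA.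
  have [t'1|t'1] := eqVneq (t' 0 ord0) 1.
    by rewrite t'1 subrr scale0r normr0 ltW.
  rewrite normrZ -(divfK (lt0r_neq0 D0) e) ler_pM //.
  rewrite (le_trans (ler_normB _ _)) // lerD2l; apply: sC.
    by rewrite (le_lt_trans (ler_norm C)) // ltrDl.
  by exists (base_point t') => //; apply: base_point_std.
have t1' : 1 - t 0 ord0 != 0 by rewrite subr_eq0 eq_sym.
apply: cvgD; first by apply: cvgZ => //; apply: cvg_cst.
apply: cvgZ => //.
apply: (@cvg_within_comp _ _ _ _ (@std_simplex R k) (@base_point k)).
- apply: cvgZ; first exact: cvgV.
  by apply: cvg_within_at; apply: cvg_tail.
- have : within (@std_simplex R k.+1) (nbhs t)
      [set t' : 'rV[R]_k.+2 | 1 - t' 0 ord0 != 0].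
    by apply: (t1c [set x | x != 0]); apply: open_nbhs_nbhs; split; [exact: open_neq|].
  apply: filterS2 (withinT _ (nbhs_filter t)) => t' St' /= t'1.
  by apply: base_point_std => //; rewrite eq_sym -subr_eq0.
- by move/subspace_continuousP: sc; apply; apply: base_point_std.
Qed.

Lemma cone_singular k (s : simplex k) :
  singular_simplex U s -> singular_simplex U (cone s).
Proof.
move=> sS; apply: simplex_patch => [|t St]; first exact: cone_point_continuous.
rewrite /cone_point; have [t1|t1] := eqVneq (t 0 ord0) 1.
  by rewrite t1 subrr scale0r scale1r addr0.
apply: starU; last by rewrite (std_simplex_le1 _ St) andbT; case: St.
by case: sS => _ sU _; apply/sU/base_point_std.
Qed.

(** Face 0 of the cone on s is s, and the other faces are the cones on the faces of
s: the cone is a contraction of the chain complex. *)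
Lemma boundary_cone k (c : chain k.+1) : singular_chain U c ->
  boundary (chain_map (@cone k.+1) c) = c - chain_map (@cone k) (boundary c).
Proof.
move=> cU; rewrite boundary_chain_map chain_map_boundary -[X in X - _]fglift_id.
rewrite -fglift_subf; apply: eq_in_fglift => s /cU sU.
rewrite big_ord_recl simplex_face_cone0 // scale1r -sumrN; congr (_ + _).
apply: eq_bigr => i _.
by rewrite simplex_face_coneS lift0 exprS mulN1r scaleNr.
Qed.

(** In degree 0 the face opposite the base is the apex, whence the augmentation. *)
Lemma boundary_cone0 (c : chain 0) : singular_chain U c ->
  boundary (chain_map (@cone 0) c) = c - augmentation c *: << apex_simplex >>.
Proof.
move=> cU; rewrite boundary_chain_map -[X in X - _]fglift_id.
have -> : augmentation c *: << apex_simplex >> =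
    fglift (fun=> << apex_simplex >> : chain 0) c.
  rewrite /augmentation !fglift_sum scaler_suml; apply: eq_bigr => s _.
  by rewrite [_ *: (1 : K^o)]mulr1.
rewrite -fglift_subf; apply: eq_in_fglift => s /cU sU.
rewrite big_ord_recl big_ord1 simplex_face_cone0 // scale1r simplex_face_cone1.
by rewrite lift0 expr1 scaleN1r.
Qed.

Lemma acyclic_star : acyclic K U.
Proof.
split; first by exists p.
- move=> c cU c0; exists (chain_map (@cone 0) c); split.
    exact: chain_map_singular (@cone_singular 0) cU.
  by rewrite boundary_cone0 // c0 scale0r subr0.
- move=> k c cU c0; exists (chain_map (@cone k.+1) c); split.
    exact: chain_map_singular (@cone_singular k.+1) cU.
  by rewrite boundary_cone // c0 /chain_map fglift0 subr0.
Qed.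

End Cone.

Lemma acyclic_convex (R : realType) (K : fieldType) n (U : set 'rV[R]_n) :
  convex U -> U !=set0 -> acyclic K U.
Proof.
by move=> cU [p Up]; apply: (@acyclic_star _ _ _ _ p) => // x a Ux; apply: cU.
Qed.

(** * Labels and sharp polytopes *)

Section Labels.
Variables (R : realType) (n : nat).
Implicit Types (x y : 'rV[R]_n) (s P : set 'rV[R]_n) (m M : 'X_{1..n}).
Implicit Types (S : set 'X_{1..n}).

Lemma is_lcm_unique S m m' : is_lcm S m -> is_lcm S m' -> m = m'.
Proof.
move=> [mS m_min] [m'S m'_min]; apply/mnmP => i; apply/eqP; rewrite eqn_leq.
by move/mnm_lepP: (m_min _ m'S) => ->; move/mnm_lepP: (m'_min _ mS) => ->.
Qed.

(** A bounded set of exponent vectors has a coordinatewise maximum. *)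
Lemma lcm_ofP S M : (forall m, S m -> (m <= M)%MM) -> is_lcm S (lcm_of S).
Proof.
move=> SM; apply: xgetPex.
have sup i : exists k, (forall m, S m -> (m i <= k)%N) /\
    (forall k', (forall m, S m -> (m i <= k')%N) -> (k <= k')%N).
  pose Q k := `[< forall m, S m -> (m i <= k)%N >].
  have exQ : exists k, Q k.
    by exists (M i); apply/asboolP => m /SM /mnm_lepP.
  case: (ex_minnP exQ) => k /asboolP Sk k_min; exists k; split=> // k' Sk'.
  exact/k_min/asboolP.
have [f fP] := choice sup; exists [multinom f i | i < n]; split.
  by move=> m Sm; apply/mnm_lepP => i; rewrite mnmE; apply: (fP i).1.
move=> m' m'S; apply/mnm_lepP => i; rewrite mnmE; apply: (fP i).2 => m Sm.
by move/mnm_lepP: (m'S m Sm).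
Qed.

(** Otherwise the i-th exponent of the least common multiple could be lowered by 1. *)
Lemma lcm_attained S M i : is_lcm S M -> (0 < M i)%N -> exists2 m, S m & m i = M i.
Proof.
move=> [SM M_min] Mi; apply: contrapT => noS.
have lt m : S m -> (m i < M i)%N.
  move=> Sm; rewrite ltn_neqAle; move/mnm_lepP: (SM m Sm) => -> //.
  by rewrite andbT; apply/eqP => mi; apply: noS; exists m.
have /mnm_lepP/(_ i) : (M <= [multinom (M j - (j == i))%N | j < n])%MM.
  apply: M_min => m Sm; apply/mnm_lepP => j; rewrite mnmE.
  have [->|_] := eqVneq j i; first by rewrite subn1 -ltnS prednK // lt.
  by rewrite subn0; move/mnm_lepP: (SM m Sm).
by rewrite mnmE eqxx subn1 -ltnS prednK // ltnn.
Qed.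

Lemma vec_inj : injective (@vec R n).
Proof.
move=> m m' /rowP mm'; apply/mnmP => i; have /eqP := mm' i.
by rewrite !mxE eqr_nat => /eqP.
Qed.

Definition nonneg s := forall x, s x -> forall i, 0 <= x 0 i.

Lemma lattice_vec x : lattice_point x -> (forall i, 0 <= x 0 i) ->
  exists m, x = vec R m.
Proof.
move=> xZ x0; have /choice[f xf] : forall i, exists k : nat, x 0 i = k%:R.
  by move=> i; apply/natrP; rewrite natrEint xZ x0.
by exists [multinom f i | i < n]; apply/rowP => i; rewrite mxE mnmE.
Qed.

Lemma vert_vec s v : lattice_polytope s -> nonneg s -> verts (faces s) v ->
  exists m, v = vec R m.
Proof.
move=> [_ sZ] s0 sv; exact: lattice_vec (sZ _ sv) (s0 _ (verts_in sv)).
Qed.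

Lemma cell_label1 m : cell_label [set vec R m] = m.
Proof.
have verts1 : [set m' | verts (faces [set vec R m]) (vec R m')] = [set m].
  rewrite predeqE => m'; split=> [/verts_in /= /vec_inj //|->].
  by apply: faces_refl; exists (vec R m).
rewrite /cell_label verts1; apply: (@is_lcm_unique [set m]).
  by apply: (@lcm_ofP _ m) => _ ->; apply/mnm_lepP.
by split=> [_ ->|m' m'1]; [apply/mnm_lepP | apply: m'1].
Qed.

Lemma polytope_bounded s : polytope s ->
  exists M, forall m, s (vec R m) -> (m <= M)%MM.
Proof.
move=> sP.
have [f fP] := choice (fun i => polytope_dot_bounded (delta_mx 0 i) sP).
exists [multinom Num.Def.archi_bound `|f i| | i < n] => m sm.
apply/mnm_lepP => i; rewrite mnmE -(ler_nat R).
have := fP i _ sm; rewrite dot_delta mxE => /le_trans; apply.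
by apply: (le_trans (ler_norm _)); apply/ltW/archi_boundP/normr_ge0.
Qed.

Lemma polytope_label_lcm s : polytope s ->
  is_lcm [set m | s (vec R m)] (polytope_label s).
Proof. by move=> /polytope_bounded[M sM]; apply: (lcm_ofP sM). Qed.

Lemma cell_label_lcm s : polytope s ->
  is_lcm [set m | verts (faces s) (vec R m)] (cell_label s).
Proof.
move=> /polytope_bounded[M sM]; apply: (@lcm_ofP _ M) => m /verts_in.
exact: sM.
Qed.

(** A coordinate is bounded by its values at the vertices, which are lattice points. *)
Lemma le_cell_label s x i : lattice_polytope s -> nonneg s -> s x ->
  x 0 i <= (cell_label s i)%:R.
Proof.
move=> sL s0 sx; have sP := sL.1; rewrite -dot_delta.
apply: (polytope_valid sP) sx => v sv; rewrite dot_delta.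
have [m vE] := vert_vec sL s0 sv; move: sv; rewrite vE mxE ler_nat => sm.
by have [/(_ m sm) /mnm_lepP] := cell_label_lcm sP.
Qed.

Lemma cell_le_polytope_label s : polytope s -> (cell_label s <= polytope_label s)%MM.
Proof.
move=> sP; have [_] := cell_label_lcm sP; apply=> m /verts_in sm.
by have [+ _] := polytope_label_lcm sP; apply.
Qed.

(** The relative interior, seen through the valid inequalities: those that are not
equalities on all of s are strict at p. *)
Definition relint s p := s p /\ forall c b z, valid s c b -> s z -> dot c z < b ->
  dot c p < b.

Lemma cut_complex_sub s t : cut_complex s t -> t `<=` s.
Proof. by move=> [_ [F [e [sF ->]]]] x [/(face_sub sF)]. Qed.

(** A cell of the cut complex lies on one side of the hyperplane x_i = k, which is
the upper side as soon as one of its points is above. *)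
Lemma cut_complex_slab s t u i k : cut_complex s t -> t u -> u 0 i = k.+1%:R ->
  forall x, t x -> k%:R <= x 0 i.
Proof.
move=> [_ [F [e [sF ->]]]] [_ ue] ui x [_ xe].
have := ue i k; have := xe i k; rewrite /on_side /=; case: (e i k) => //.
  by move=> -> _.
by move=> _; rewrite ui ler_nat ltnn.
Qed.

(** The average of an affine frame of the full-dimensional cell t cannot lie on a
proper face of s, since that face would contain the frame. Averaging also with a
point of t of maximal i-th coordinate, for each i, makes the i-th coordinate
strictly larger than the lower bound M_i - 1 valid on t. *)
Lemma sharp_point s : sharp s -> exists2 p, relint s p &
  forall m i, (m i < polytope_label s i)%N -> (m i)%:R < p 0 i.
Proof.
move=> [[[sP _] _] [t [st dt lt]]].
have t0 := st.1; have ts := cut_complex_sub st.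
have [x [A [tx tA fA]]] := affdim_frame t0.
have tL : is_lcm [set m | verts (faces t) (vec R m)] (polytope_label s).
  rewrite -lt; apply: (@lcm_ofP _ (polytope_label s)) => m /verts_in /ts sm.
  by have [+ _] := polytope_label_lcm sP; apply.
have /choice[u uP] : forall i, exists y, t y /\
    ((0 < polytope_label s i)%N -> y 0 i = (polytope_label s i)%:R).
  move=> i; have [le0|gt0] := leqP (polytope_label s i) 0; first by exists x.
  have [m mt mi] := lcm_attained tL gt0; exists (vec R m); split.
    exact: verts_in mt.
  by rewrite mxE mi.
pose q (a : option 'I_(affdim t) + 'I_n) : 'rV[R]_n := match a with
  | inl None => x | inl (Some j) => x + row j A | inr i => u i end.
have tq a : t (q a) by case: a => [[j|]|i] //=; case: (uP i).
exists (average q).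
  have I0 : (0 < #|{: option 'I_(affdim t) + 'I_n}|)%N.
    by apply/card_gt0P; exists (inl None).
  split=> [|c b z cs sz cz].
    by apply: (polytope_dual sP) => c b cs; apply: dot_average_le => // a; apply/cs/ts.
  have cq a : dot c (q a) <= b by apply/cs/ts.
  rewrite ltNge; apply/negP => cp.
  have cqE a : dot c (q a) = b.
    apply/eqP; rewrite eq_le cq leNgt; apply/negP => cqa.
    by move: (dot_average_lt cq cqa); rewrite ltNge cp.
  have := affdim_hyperplane cs sz cz.
  have frame a : (s `&` [set y | dot c y = b]) (q a).
    by split; [apply: ts | apply: cqE].
  move=> /(_ (ex_intro _ _ (frame (inl None)))); rewrite -dt ltnNge.
  by rewrite (le_affdim (frame (inl None)) (fun j => frame (inl (Some j))) fA).
move=> m i mi; have gt0 : (0 < polytope_label s i)%N by apply: leq_ltn_trans mi.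
have [tui /(_ gt0) ui] := uP i.
have slab y : t y -> (m i)%:R <= y 0 i.
  move=> ty; have ui' : u i 0 i = (polytope_label s i).-1.+1%:R by rewrite prednK.
  apply: le_trans (cut_complex_slab st tui ui' ty).
  by rewrite ler_nat -ltnS prednK.
rewrite -[p in _ < p]opprK ltrNr -dot_delta -mulN1r -dotZl.
apply: (@dot_average_lt _ _ _ _ _ _ (inr i)) => [a|].
  by rewrite dotZl mulN1r dot_delta lerN2; apply/slab/tq.
by rewrite dotZl mulN1r dot_delta ltrN2 /= ui ltr_nat.
Qed.

End Labels.

(** * Radial projection of a polytope onto its boundary *)

Section Radial.
Variables (R : realType) (n : nat).
Implicit Types (c p x y : 'rV[R]_n) (F s : set 'rV[R]_n).
Implicit Type L : seq ('rV[R]_n * R).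

(** When L lists inequalities for the proper faces of a polytope with p in its relative
interior, this is the Minkowski functional of the polytope with center p; the
default 0 is harmless, since the functional is nonnegative. *)
Definition gauge L p x : R :=
  \big[Num.max/0]_(f <- L) (dot f.1 (x - p) / (f.2 - dot f.1 p)).

Lemma gauge_continuous L p : continuous (gauge L p).
Proof.
have maxc : continuous (fun z : R * R => Num.max z.1 z.2).
  by move=> z; apply: continuous_max; [exact: cvg_fst | exact: cvg_snd].
apply: (@continuous_big R _ Num.max 0 xpredT maxc _ L
  (fun f x => dot f.1 (x - p) / (f.2 - dot f.1 p))) => f _ x.
apply: (@cvgM R _ (nbhs x) _ (fun x => dot f.1 (x - p)) (fun=> _)); last exact: cvg_cst.
apply: (@continuous_comp _ _ _ (fun x => x - p) (dot f.1)); last exact: dot_continuous.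
exact: (cvgB cvg_id (cvg_cst p)).
Qed.

Definition radial L p x := p + (gauge L p x)^-1 *: (x - p).

Lemma radial_continuous L p x : gauge L p x != 0 -> {for x, continuous (radial L p)}.
Proof.
move=> gx; have gc := cvgV gx (@gauge_continuous L p x).
exact: (cvgD (cvg_cst p) (cvgZ (gc _) (cvgB cvg_id (cvg_cst p)))).
Qed.

(** Each ratio is homogeneous in x - p, and at the exit point of the ray the largest
ratio is 1. *)
Lemma gauge_ray L p x t : 0 < t ->
  (forall f, f \in L -> dot f.1 p < f.2) ->
  (forall f, f \in L -> dot f.1 (p + t *: (x - p)) <= f.2) ->
  (exists2 f, f \in L & dot f.1 (p + t *: (x - p)) = f.2) ->
  gauge L p x = t^-1.
Proof.
move=> t0 Lp Lx [f fL fx]; apply/eqP; rewrite eq_le; apply/andP; split.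
  rewrite /gauge big_seq; apply: bigmax_le => [|h hL]; first by rewrite invr_ge0 ltW.
  rewrite ler_pdivrMr ?subr_gt0 ?Lp // ler_pdivlMl //.
  by rewrite lerBrDl -dotZr -dotDr Lx.
have fp : f.2 - dot f.1 p != 0 by rewrite subr_eq0 gt_eqF // Lp.
suff <- : dot f.1 (x - p) / (f.2 - dot f.1 p) = t^-1 by apply: (le_bigmax_seq 0 f xpredT
    (fun h : 'rV[R]_n * R => dot h.1 (x - p) / (h.2 - dot h.1 p)) fL).
apply: (@mulfI _ t); first by rewrite gt_eqF.
have fE : f.2 - dot f.1 p = dot f.1 (t *: (x - p)).
  by rewrite -fx dotDr [dot f.1 p + _]addrC addrK.
by rewrite mulfV ?gt_eqF // mulrA -dotZr -fE mulfV.
Qed.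

(** One inequality for each proper face. They are strict at p, because p lies on no
proper face, so that they can be normalized there; as there are finitely many of
them, their maximum is continuous. *)
Lemma proper_face_ineqs s p (l : seq (set 'rV[R]_n)) : relint s p ->
  (forall F, faces s F -> F \in l) -> exists L : seq ('rV[R]_n * R),
  [/\ forall f, f \in L -> valid s f.1 f.2,
      forall f, f \in L -> dot f.1 p < f.2,
      forall f, f \in L -> (exists2 y, s y & dot f.1 y = f.2) ->
        faces s (s `&` [set x | dot f.1 x = f.2])
    & forall F, faces s F -> F <> s ->
        exists2 f, f \in L & F = s `&` [set x | dot f.1 x = f.2]].
Proof.
move=> [sp ps] sl.
have /choice[phi phiP] : forall F, exists f : 'rV[R]_n * R,
    faces s F -> valid s f.1 f.2 /\ F = s `&` [set x | dot f.1 x = f.2].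
  move=> F; have [[_ [c [b [cs FE]]]]|nF] := pselect (faces s F).
    by exists (c, b).
  by exists (0, 0).
exists [seq phi F | F <- l & `[< faces s F /\ F <> s >]].
have Lf f : f \in [seq phi F | F <- l & `[< faces s F /\ F <> s >]] ->
    exists F, [/\ faces s F, F <> s, f = phi F & valid s f.1 f.2].
  move=> /mapP[F]; rewrite mem_filter => /andP[/asboolP[sF Fs] _] ->.
  by exists F; split=> //; apply: (phiP F sF).1.
split.
- by move=> f /Lf[F []].
- move=> f /Lf[F [sF Fs fE fs]].
  have [z sz fz] : exists2 z, s z & dot f.1 z < f.2.
    apply: contrapT => noz; apply: Fs; rewrite (phiP F sF).2 -fE predeqE => x.
    split=> [[]//|sx]; split=> //=; apply/eqP; rewrite eq_le fs // leNgt.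
    by apply/negP => fx; apply: noz; exists x.
  exact: ps fs sz fz.
- move=> f /Lf[F [_ _ _ fs]] [y sy fy]; split; first by exists y.
  by exists f.1, f.2.
- move=> F sF Fs; exists (phi F); last exact: (phiP F sF).2.
  by apply: map_f; rewrite mem_filter sl // andbT; apply/asboolP.
Qed.

Definition beyond p x y := exists2 t, 1 <= t & y = p + t *: (x - p).

(** The ray from p through x leaves s at a point of a proper face. That point has
gauge 1, so the formula that divides x - p by the gauge of x computes it, and
continuity of the gauge makes the projection continuous away from p. *)
Lemma radial_retraction s p (l : seq (set 'rV[R]_n)) : polytope s -> relint s p ->
  (forall F, faces s F -> F \in l) -> exists r : 'rV[R]_n -> 'rV[R]_n,
  [/\ forall x, s x -> x != p -> {for x, continuous r},
      forall x, s x -> x != p -> exists F, [/\ faces s F, F <> s & F (r x)],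
      forall x, s x -> x != p -> beyond p x (r x)
    & forall x F, faces s F -> F <> s -> F x -> r x = x].
Proof.
move=> sP pI sl; have [sp ps] := pI.
have [L [Ls Lp Lface Lcov]] := proper_face_ineqs pI sl.
have Fp f : f \in L -> (s `&` [set x | dot f.1 x = f.2]) <> s.
  by move=> fL /predeqP/(_ p)[_ /(_ sp)[_ /= fp]]; move: (Lp f fL); rewrite fp ltxx.
have radialP x : s x -> x != p -> exists2 t, 1 <= t &
    [/\ gauge L p x = t^-1, s (p + t *: (x - p)) &
        exists2 f, f \in L & dot f.1 (p + t *: (x - p)) = f.2].
  move=> sx xp; have [t t1 [sy bd]] := ray_exit sP sp sx xp.
  have t0 : 0 < t by apply: lt_le_trans t1.
  have [e e0|c [b [cs cp cy]]] := boundary_point sP sp sy.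
    rewrite [p + _ - p]addrAC subrr add0r scalerA -addrA -scalerDl.
    by apply: bd; rewrite mulr_gt0.
  have [||f fL FE] := Lcov (s `&` [set x | dot c x = b]).
  - by split; [exists (p + t *: (x - p)) | exists c, b].
  - by move=> /predeqP/(_ p)[_ /(_ sp)[_ /= cpE]]; move: cp; rewrite cpE ltxx.
  exists t => //; have fy : dot f.1 (p + t *: (x - p)) = f.2.
    by have /predeqP/(_ (p + t *: (x - p)))[/(_ (conj sy cy)) []] := FE.
  by split=> //; [apply: gauge_ray => // [h hL|]; [apply: Ls | exists f] | exists f].
exists (radial L p); split.
- move=> x sx xp; apply: radial_continuous.
  have [t t1 [-> _ _]] := radialP x sx xp.
  by rewrite invr_eq0 gt_eqF // (lt_le_trans ltr01).
- move=> x sx xp; have [t t1 [gx sy [f fL fy]]] := radialP x sx xp.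
  exists (s `&` [set x | dot f.1 x = f.2]); split; last 1 first.
  + by rewrite /radial gx invrK.
  + by apply: Lface => //; exists (p + t *: (x - p)).
  + exact: Fp.
- move=> x sx xp; have [t t1 [gx _ _]] := radialP x sx xp.
  by exists t; rewrite // /radial gx invrK.
- move=> x F sF Fs Fx; have [f fL FE] := Lcov F sF Fs.
  have : (s `&` [set x | dot f.1 x = f.2]) x by rewrite -FE.
  move=> [sx fx]; have xE : p + 1 *: (x - p) = x by rewrite scale1r addrC subrK.
  rewrite /radial (@gauge_ray _ _ _ 1) ?invr1 // xE.
    by move=> h hL; apply: Ls.
  by exists f.
Qed.

(** A polytope is the intersection of its valid closed half-spaces. *)
Lemma polytope_closed s : polytope s -> closed s.
Proof.
move=> sP; rewrite (_ : s = \bigcap_(f in [set f : 'rV[R]_n * R | valid s f.1 f.2])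
    [set x | dot f.1 x <= f.2]).
  apply: closed_bigI => f _.
  apply: (@preimage_closed _ _ (dot f.1) [set x | x <= f.2]); last exact: closed_le.
  by move=> x _; apply: dot_continuous.
rewrite predeqE => x; split=> [sx f|sx]; first by apply.
by apply: (polytope_dual sP) => c b cs; apply: (sx (c, b)).
Qed.

End Radial.

(** * Removing the cells whose label does not divide a monomial *)

Section CellRemoval.
Variables (R : realType) (n : nat) (X : set (set 'rV[R]_n)) (m : 'X_{1..n}).
Hypothesis Xcomplex : polytopal_complex X.
Hypothesis Xnonneg : forall s, X s -> nonneg s.
Hypothesis Xsharp : forall s, X s -> sharp s.
Implicit Types (S : set (set 'rV[R]_n)) (s F : set 'rV[R]_n).

Definition box : set 'rV[R]_n := [set x | forall i, x 0 i <= (m i)%:R].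

Definition below S : set 'rV[R]_n := \bigcup_(s in S) (s `&` box).

Definition face_closed S := forall s F, S s -> faces s F -> S F.

Lemma box_closed : closed box.
Proof.
rewrite (_ : box = \bigcap_i [set x | x 0 i <= (m i)%:R]).
  apply: closed_bigI => i _.
  apply: (@preimage_closed _ _ (fun x : 'rV[R]_n => x 0 i) [set a | a <= (m i)%:R]).
    by move=> x _; apply: coord_continuous.
  exact: closed_le.
by rewrite predeqE => x; split=> [xm i _|xm i]; apply: xm.
Qed.

Lemma below_closed S : S `<=` X -> closed (below S).
Proof.
case: Xcomplex => Xfin Xpoly _ _ SX; apply: closed_bigcup.
  exact: sub_finite_set Xfin.
move=> s /SX /Xpoly[sP _]; apply: closedI; [exact: polytope_closed | exact: box_closed].
Qed.

(** The retraction is the radial projection on s and the identity on the other cells.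
The two agree where they meet, since s meets another cell in a proper face of s,
whose points the projection fixes. *)
Lemma remove_cell S s : S `<=` X -> face_closed S -> S s ->
  (forall t, S t -> s `<=` t -> t = s) -> ~ (cell_label s <= m)%MM ->
  retract (below S) (below (S `\ s)).
Proof.
move=> SX Sfaces Ss smax slab; have [Xfin Xpoly _ Xcap] := Xcomplex.
have Xs := SX s Ss; have [sP s0] := Xpoly s Xs; have sS := Xsharp Xs.
have [[sL _] _] := sS; have snn := Xnonneg Xs.
have [p pI pm] := sharp_point sS.
have [l lX] : exists l : seq (set 'rV[R]_n), X = [set` l] by apply/finite_seqP.
have [|r [rc rF rray rid]] := @radial_retraction _ _ s p l sP pI.
  by move=> F sF; have := Sfaces _ _ Ss sF => /SX; rewrite lX.
have bad_coord : exists i, (m i < polytope_label s i)%N.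
  apply: contrapT => nobad; apply: slab; apply/mnm_lepP => i.
  have /mnm_lepP/(_ i) le := cell_le_polytope_label sP.
  by rewrite (leq_trans le) // leqNgt; apply/negP => lt; apply: nobad; exists i.
have neqp x : box x -> x != p.
  have [i /pm lt] := bad_coord; move=> /(_ i) xm.
  by apply: contraTneq lt => <-; rewrite -leNgt.
pose r' x := if `[< s x >] then r x else x.
have r'id x : below (S `\ s) x -> r' x = x.
  move=> [t [St ts] [tx xm]]; rewrite /r'; case: asboolP => // sx.
  have [|sst _] := Xcap s t Xs (SX t St); first by exists x.
  apply: (rid x (s `&` t)) => // stE; apply: ts => /=; apply: smax => // y.
  by rewrite -{1}stE => -[].
have belowE : below S = (s `&` box) `|` below (S `\ s).
  rewrite predeqE => x; split=> [[t St [tx xm]]|[xs|[t [St _] xt]]].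
  - have [ts|ts] := pselect (t = s); first by left; rewrite -ts.
    by right; exists t.
  - by exists s.
  - by exists t.
exists r'; split=> [|x|//].
- rewrite belowE; apply: withinU_continuous.
  + by apply: closedI; [exact: polytope_closed | exact: box_closed].
  + by apply: below_closed => t [/SX].
  + apply: (@eq_within _ _ _ r) => [x [sx _]|]; first by rewrite /r' asboolT.
    apply: continuous_in_subspaceT => x; rewrite inE => -[sx xm].
    exact: rc sx (neqp _ xm).
  + apply: (@eq_within _ _ _ id) => [x xS|]; first by rewrite r'id.
    by apply: continuous_subspaceT => x; apply: cvg_id.
- rewrite {1}belowE => -[[sx xm]|xS]; last by rewrite r'id.
  have xp := neqp x xm; rewrite /r' asboolT //.
  have [F [sF Fs Fr]] := rF x sx xp.
  exists F; first by split; [exact: Sfaces sF |].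
  split=> // i; have [lt|ge] := ltnP (m i) (polytope_label s i).
    (* From p to x the coordinate i decreases, and it goes on decreasing. *)
    have [t t1 ->] := rray x sx xp; have := pm _ _ lt; have := xm i.
    rewrite !mxE => xi pi; nra.
  apply: (le_trans (le_cell_label i sL snn (face_sub sF Fr))).
  rewrite ler_nat (leq_trans _ ge) //.
  by have /mnm_lepP := cell_le_polytope_label sP; apply.
Qed.

Lemma affdim_le s : (affdim s <= n)%N.
Proof. by apply/bigmax_leqP => i _; rewrite -ltnS ltn_ord. Qed.

(** The list l, which contains the bad cells of S, only serves as the measure of the
induction. *)
Lemma retract_good (K : fieldType) (l : seq (set 'rV[R]_n)) S :
  S `<=` X -> face_closed S ->
  (forall s, X s -> (cell_label s <= m)%MM -> S s) ->
  (forall s, S s -> ~ (cell_label s <= m)%MM -> s \in l) ->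
  acyclic K (below S) -> acyclic K (below (subcomplex_le X (@cell_label R n) m)).
Proof.
have [N] := ubnP (size l); elim: N => // N IHN in l S *; rewrite ltnS => lN.
move=> SX Sfaces Sgood Sbad Sac.
pose bad s := S s /\ ~ (cell_label s <= m)%MM.
have [[s0 bad0]|nobad] := pselect (exists s, bad s); last first.
  suff -> : subcomplex_le X (@cell_label R n) m = S by [].
  rewrite predeqE => s; split=> [[]|Ss]; first exact: Sgood.
  split; first exact: SX.
  by apply: contrapT => sm; apply: nobad; exists s.
(* A bad cell of maximal dimension lies in no other bad cell, and it lies in no
   good cell either, because the faces of a good cell are good. *)
pose Q d := `[< exists2 s, bad s & affdim s = d >].
have exQ : exists d, Q d by exists (affdim s0); apply/asboolP; exists s0.
have Qn d : Q d -> (d <= n)%N by move=> /asboolP[s _ <-]; apply: affdim_le.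
case: (ex_maxnP exQ Qn) => d /asboolP[s [Ss sm] <-] dmax.
have [Xfin Xpoly Xfaces Xcap] := Xcomplex.
have label_mono t : S t -> faces t s -> (cell_label t <= m)%MM -> (cell_label s <= m)%MM.
  move=> St ts /mnm_lepP tm; have [[sL _] _] := Xsharp (SX _ Ss).
  have [_] := cell_label_lcm sL.1; apply=> k sk; apply/mnm_lepP => i.
  apply: leq_trans (tm i); rewrite -(ler_nat R).
  have [[tL _] _] := Xsharp (SX _ St).
  have := le_cell_label i tL (Xnonneg (SX _ St)) (face_sub ts (verts_in sk)).
  by rewrite mxE.
have smax t : S t -> s `<=` t -> t = s.
  move=> St st; have [_ s_ne] := Xpoly s (SX _ Ss).
  have ts : faces t s.
    have [|_] := Xcap s t (SX _ Ss) (SX _ St); rewrite (setIidl st) //.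
  apply: contrapT => /nesym/(affdim_face ts); rewrite ltnNge => /negP; apply.
  apply: dmax; apply/asboolP; exists t => //; split=> // tm.
  exact/sm/(label_mono t).
have rs := remove_cell SX Sfaces Ss smax sm.
apply: (IHN [seq t <- l | t != s] (S `\ s)).
- apply: leq_trans lN; rewrite size_filter -(count_predC (pred1 s) l) addnC.
  by rewrite -[X in (X < _)%N]addn0 ltn_add2l -has_count has_pred1 Sbad.
- by move=> t [/SX].
- move=> t F [St ts] tF; split; first exact: Sfaces tF.
  move=> /= FE; apply: ts => /=; apply: smax => //; rewrite -FE.
  exact: face_sub tF.
- move=> t Xt tm; split; first exact: Sgood.
  by move=> /= tE; apply: sm; rewrite -tE.
- move=> t [St ts] tm; rewrite mem_filter Sbad // andbT.
  by apply/eqP.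
- apply: acyclic_retract rs Sac => x [t [St _] xt].
  by exists t.
Qed.

Lemma below_good : below (subcomplex_le X (@cell_label R n) m) =
  \bigcup_(s in subcomplex_le X (@cell_label R n) m) s.
Proof.
rewrite predeqE => x; split=> [[s sm [sx _]]|[s [Xs sm] sx]]; first by exists s.
exists s => //; split=> // i; have [[sL _] _] := Xsharp Xs.
apply: (le_trans (le_cell_label i sL (Xnonneg Xs) sx)).
by rewrite ler_nat; move/mnm_lepP: sm.
Qed.

Lemma acyclic_subcomplex (K : fieldType) (P : set 'rV[R]_n) :
  convex P -> \bigcup_(s in X) s = P -> (P `&` box) !=set0 ->
  acyclic K (\bigcup_(s in subcomplex_le X (@cell_label R n) m) s).
Proof.
move=> Pconv XP Pm; have [Xfin _ Xfaces _] := Xcomplex.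
have [l lX] : exists l : seq (set 'rV[R]_n), X = [set` l] by apply/finite_seqP.
rewrite -below_good; apply: (@retract_good K l X) => //.
  by move=> s; rewrite lX.
rewrite /below -setI_bigcupl XP; apply: acyclic_convex => // x y a [Px xm] [Py ym] a01.
split; first exact: Pconv.
move=> i; rewrite !mxE; have := xm i; have := ym i; case/andP: a01 => a0 a1; nra.
Qed.

End CellRemoval.

Theorem theorem4p2 (R : realType) (K : fieldType) (n : nat)
    (P : set 'rV[R]_n) (X : set (set 'rV[R]_n)) :
  (forall x, P x -> forall i, 0 <= x 0 i) ->
  diced P ->
  polytopal_subdivision P X ->
  (forall s, X s -> totally_sharp s) ->
  cellular_resolution X (@cell_label R n) (lattice_ideal K P).
Proof.
move=> P0 [[PP _] _] [Xcomplex XP] Xts; have [Xfin Xpoly Xfaces Xcap] := Xcomplex.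
have Xsharp s : X s -> sharp s.
  by move=> Xs; apply: (Xts s Xs); apply: faces_refl; apply: (Xpoly s Xs).2.
have sub s : X s -> s `<=` P by move=> Xs x sx; rewrite -XP; exists s.
have Xnonneg s : X s -> nonneg s by move=> Xs x sx; apply: P0; apply: sub sx.
have XL s : X s -> lattice_polytope s by move=> /Xsharp[[]].
have vertP v : verts X v -> exists2 m, v = vec R m & P (vec R m).
  move=> Xv; have v0 : [set v] !=set0 by exists v.
  have [m vE] := vert_vec (XL _ Xv) (Xnonneg _ Xv) (faces_refl v0).
  by exists m => //; rewrite -vE; apply: (sub _ Xv).
have acyc m : (P `&` box m) !=set0 ->
    acyclic K (\bigcup_(s in subcomplex_le X (@cell_label R n) m) s).
  exact: acyclic_subcomplex Xcomplex Xnonneg Xsharp _ _ (polytope_convex PP) XP.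
split.
- split=> // s Xs; have [sm s_min] := cell_label_lcm (XL s Xs).1.
  split=> [_ [v sv <-]|k sk].
    have [m vE] := vert_vec (XL s Xs) (Xnonneg s Xs) sv.
    by rewrite vE cell_label1; apply: sm; rewrite /= -vE.
  apply: s_min => m sv; rewrite -(cell_label1 R m); apply: sk.
  by exists (vec R m).
- rewrite predeqE => q; split=> -[k [a [g [gS ->]]]].
  + have /choice[h hP] : forall i, exists h : {mpoly K[n]} * {mpoly K[n]},
        g i = h.1 * h.2 /\ [set 'X_[cell_label [set v]] | v in verts X] h.2.
      move=> i; have [m Pm <-] := gS i.
      (* An acyclic set is nonempty, so some cell has a label dividing m. *)
      have [|[x [s [Xs sm] sx]] _ _] := acyc m.
        by exists (vec R m); split=> // j; rewrite mxE.
      have [v sv] := polytope_vertex (Xpoly s Xs).1 (ex_intro _ x sx).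
      have [k' vE] := vert_vec (XL s Xs) (Xnonneg s Xs) sv.
      have km : (k' <= m)%MM.
        apply: lepm_trans sm; have [+ _] := cell_label_lcm (XL s Xs).1; apply.
        by rewrite /= -vE.
      exists ('X_[m - k'], 'X_[k']); rewrite -mpolyXD submK //; split=> //.
      by exists v; [exact: Xfaces sv | rewrite vE cell_label1].
    exists k, (fun i => a i * (h i).1), (fun i => (h i).2); split.
      by move=> i; apply: (hP i).2.
    by apply: eq_bigr => i _; rewrite (hP i).1 mulrA.
  + exists k, a, g; split=> // i; have [v Xv <-] := gS i.
    have [m vE Pm] := vertP v Xv.
    by exists m => //; rewrite vE cell_label1.
- move=> m; have [|/eqP/set0P[s [Xs sm]]] :=
    pselect (subcomplex_le X (@cell_label R n) m = set0); first by left.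
  right; apply: acyc.
  have [x sx] := (Xpoly s Xs).2; exists x; split; first exact: sub sx.
  move=> i; apply: (le_trans (le_cell_label i (XL s Xs) (Xnonneg s Xs) sx)).
  by rewrite ler_nat; move/mnm_lepP: sm.
Qed.
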